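(* Let $\ell$ be a positive integer. If $G$ is a graph with minimum degree at least $\ell$, then $\mathrm{a}_\ell'(G) \le \widetilde{\gamma}_\ell(G)$.
   Context: Graphs are finite, simple and undirected. For positive integers $a,b$, the $(a,b)$-biased Maker-Breaker domination game on a graph $G$ is played by Dominator and Staller, who move alternately; on each move Dominator selects $a$ unplayed vertices and Staller selects $b$ unplayed vertices (if fewer unplayed vertices remain than the player's bias, the player selects all remaining ones). Dominator wins if the vertices he selected during the game form a dominating set of $G$; otherwise Staller wins, equivalently, Staller wins iff she claims all vertices of the closed neighborhood of some vertex. In the S-game Staller moves first, and $\mathrm{a}'_\ell(G)$ is the minimum positive integer $a$ such that Dominator wins the $(a,\ell)$-biased S-game on $G$ under optimal play ($\infty$ if no such $a$ exists). The $\ell$-local domination number: let $G$ be a graph with minimum degree $\delta(G)\ge \ell$. For $S\subseteq V(G)$ with $|S|=\ell$, let $N(S)=\bigcup_{v\in S}N(v)$, where $N(v)$ is the open neighborhood of $v$, and let $\widetilde{\gamma}_\ell(G,S)$ be the minimum number of vertices in $V(G)\setminus S$ that can dominate $N(S)\cup\{v\in S: \deg(v)=\ell\}$ (i.e. the minimum size of a set $R\subseteq V(G)\setminus S$ such that every vertex of $N(S)\cup\{v\in S: \deg(v)=\ell\}$ belongs to $R$ or has a neighbor in $R$). Then $\widetilde{\gamma}_\ell(G)=\max\{\widetilde{\gamma}_\ell(G,S): S\subseteq V(G),\ |S|=\ell\}$. *)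

(* Defs.v *)
From mathcomp Require Import all_boot.
From mathcomp Require Import boolp.

Set Implicit Arguments.
Unset Strict Implicit.
Unset Printing Implicit Defensive.

Record sgraph := SGraph {
  vertex :> finType;
  adj : rel vertex;
  adj_sym : symmetric adj;
  adj_irrefl : irreflexive adj }.

Section Domination.
Variable G : sgraph.
Implicit Types (v u w : G) (S R D : {set G}).

Definition nbhd v : {set G} := [set u | adj v u].

Definition degree v : nat := #|nbhd v|.

(* Every degree is less than #|G|, so the initial value is irrelevant unless G
   has no vertex; the minimum degree of the graph without vertices is 0. *)
Definition min_degree : nat := \big[minn/#|G|]_(v : G) degree v.

Definition dominates R v : bool := (v \in R) || [exists w in R, adj v w].

Definition dominating_set D : bool := [forall v, dominates D v].

Definition set_nbhd S : {set G} := \bigcup_(v in S) nbhd v.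

Definition local_targets (l : nat) S : {set G} :=
  set_nbhd S :|: [set v in S | degree v == l].

Definition local_dominating (l : nat) S R : bool :=
  (R \subset ~: S) && [forall v in local_targets l S, dominates R v].

(* A minimum over a nonempty family when #|S| = l <= min_degree (take
   R = ~: S); the initial value #|G| bounds every #|R|, so it does not then
   affect the result. *)
Definition local_dom_number_at (l : nat) S : nat :=
  \big[minn/#|G|]_(R : {set G} | local_dominating l S R) #|R|.

Definition local_dom_number (l : nat) : nat :=
  \max_(S : {set G} | #|S| == l) local_dom_number_at l S.

End Domination.

Inductive player := Dominator | Staller.

Section Game.
Variable G : sgraph.
Implicit Types (D S A B : {set G}).

Definition unplayed D S : {set G} := ~: (D :|: S).

Definition legal_move (k : nat) D S A : Prop :=
  A \subset unplayed D S /\ #|A| = minn k #|unplayed D S|.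

(* [dominator_wins a b p D S]: Dominator can force a win in the (a,b)-biased
   game from the position in which Dominator holds D, Staller holds S and
   player p is to move.  A derivation is a winning strategy tree; for positive
   biases every play is finite, so the inductive reading loses nothing. *)
Inductive dominator_wins (a b : nat) : player -> {set G} -> {set G} -> Prop :=
| wins_end p D S :
    unplayed D S = set0 -> dominating_set D -> dominator_wins a b p D S
| wins_dominator_move D S A :
    unplayed D S <> set0 -> legal_move a D S A ->
    dominator_wins a b Staller (D :|: A) S ->
    dominator_wins a b Dominator D S
| wins_staller_move D S :
    unplayed D S <> set0 ->
    (forall B, legal_move b D S B ->
       dominator_wins a b Dominator D (S :|: B)) ->
    dominator_wins a b Staller D S.

Definition dominator_wins_Sgame (a b : nat) : Prop :=
  dominator_wins a b Staller set0 set0.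

(* [None] stands for infinity. *)
Definition Sgame_threshold (l : nat) : option nat :=
  if pselect (exists a, (0 < a) && `[< dominator_wins_Sgame a l >]) is left ex
  then Some (ex_minn ex) else None.

End Game.

Definition leq_infty (x y : option nat) : bool :=
  match x, y with
  | _, None => true
  | None, Some _ => false
  | Some m, Some n => m <= n
  end.

(* Main.v *)
(* Call [v] safe when Dominator dominates it.  After each of his moves
   Dominator ensures that no unsafe vertex has a neighbor held by Staller and
   that no unsafe vertex of degree [l] is held by Staller.  Against a move [B]
   of Staller he takes an optimal [R] for [B].  A vertex [r] of [R] that Staller
   already holds has only safe neighbors, so it could only serve to dominate
   [r] itself; if [r] is unsafe, its degree exceeds [l], hence it has a neighbor
   outside [B], which is unplayed and replaces [r].  If Staller's move [B]
   exhausts the board, an unsafe [v] would have its whole neighborhood in [B],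
   so [degree v = #|B| = l] and [v] is not in [B]; then Staller held [v] before,
   which is excluded. *)
Require Import Defs.
From mathcomp Require Import all_boot.
From mathcomp Require Import boolp.

Set Implicit Arguments.
Unset Strict Implicit.
Unset Printing Implicit Defensive.

(** * Finite sets of prescribed size and minima of finite families *)

Lemma superset_card (T : finType) (A U : {set T}) (k : nat) :
  A \subset U -> #|A| <= k ->
  exists A' : {set T}, [/\ A \subset A', A' \subset U & #|A'| = minn k #|U|].
Proof.
move=> sAU leAk; have leAU := subset_leq_card sAU.
have le_m : minn k #|U| - #|A| <= #|U :\: A|.
  by rewrite cardsDS // leq_sub2r // geq_minr.
have [s [sub_s uniq_s size_s]] : exists s : seq T,
    [/\ {subset s <= U :\: A}, uniq s & size s = minn k #|U| - #|A|].
  exists (take (minn k #|U| - #|A|) (enum (U :\: A))); split.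
  - by move=> x /mem_take; rewrite mem_enum.
  - exact/take_uniq/enum_uniq.
  - by apply: size_takel; rewrite -cardE.
exists (A :|: [set x in s]); split; first exact: subsetUl.
- rewrite subUset sAU; apply/subsetP => x; rewrite inE => /sub_s.
  by rewrite inE => /andP[].
- rewrite cardsU [_ :&: _](_ : _ = set0); last first.
    apply/setP => x; rewrite !inE; apply/negP => /andP[xA /sub_s].
    by rewrite inE xA.
  rewrite cards0 subn0 cardsE (card_uniqP uniq_s) size_s subnKC //.
  by rewrite leq_min leAk.
Qed.

Lemma bigminn_leP (I : finType) (P : pred I) (F : I -> nat) (m a : nat) :
  reflect (m <= a \/ exists2 i, P i & F i <= a)
          (\big[minn/m]_(i | P i) F i <= a).
Proof.
apply: (iffP idP) => [|[le_ma|[i Pi le_Fa]]].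
- elim/big_ind: _ => [|x y IHx IHy|i Pi ?]; first by left.
    by rewrite geq_min => /orP[/IHx|/IHy].
  by right; exists i.
- by elim/big_rec: _ => // i x _ le_xa; rewrite geq_min le_xa orbT.
- have : i \in index_enum I by exact: mem_index_enum.
  elim: index_enum => // j r IHr; rewrite inE big_cons => /orP[/eqP<-|/IHr le_a].
    by rewrite Pi geq_min le_Fa.
  by case: ifP => // _; rewrite geq_min le_a orbT.
Qed.

(** * Domination and the local domination number *)

Section Domination.
Variable G : sgraph.
Implicit Types (v w r : G) (S T R D A B : {set G}).

Lemma in_nbhd v w : (w \in nbhd v) = adj v w.
Proof. by rewrite inE. Qed.

Lemma min_degree_le v : min_degree G <= degree v.
Proof. by apply/bigminn_leP; right; exists v. Qed.

Lemma min_degree_card : min_degree G <= #|G|.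
Proof. by apply/bigminn_leP; left. Qed.

Lemma dominatesS D R v : D \subset R -> dominates D v -> dominates R v.
Proof.
move=> /subsetP sDR /orP[/sDR vR|/existsP[w /andP[/sDR wR vw]]].
  by rewrite /dominates vR.
by apply/orP; right; apply/existsP; exists w; rewrite wR.
Qed.

Lemma dominates_adj D v w : w \in D -> adj v w -> dominates D v.
Proof. by move=> wD vw; apply/orP; right; apply/existsP; exists w; rewrite wD. Qed.

Lemma in_local_targets l S v :
  reflect ((exists2 w, w \in S & adj v w) \/ (v \in S /\ degree v = l))
          (v \in local_targets l S).
Proof.
rewrite in_setU inE; apply: (iffP orP) => -[].
- by case/bigcupP => w wS; rewrite in_nbhd adj_sym; left; exists w.
- by case/andP => vS /eqP; right.
- by case=> w wS vw; left; apply/bigcupP; exists w; rewrite // in_nbhd adj_sym.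
- by case=> vS /eqP dv; right; rewrite vS.
Qed.

Section MinDegree.
Variable l : nat.
Hypothesis l_gt0 : 0 < l.
Hypothesis l_deg : l <= min_degree G.

(** A vertex of [S] has at least [l] neighbors, but only [l - 1] other vertices lie in [S], so some
    neighbor falls outside [S]. *)
Lemma local_dominating_setC S : #|S| = l -> local_dominating l S (~: S).
Proof.
move=> cardS; rewrite /local_dominating subxx; apply/forall_inP => v _.
have [vS|vNS] := boolP (v \in S); last by rewrite /dominates inE vNS.
have [w vw wNS] : exists2 w, w \in nbhd v & w \notin S :\ v.
  apply/subsetPn/negP => /subset_leq_card.
  have := leq_trans l_deg (min_degree_le v).
  rewrite /degree => le_l /(leq_trans le_l).
  by rewrite -cardS (cardsD1 v S) vS ltnn.
apply: (@dominates_adj _ _ w); last by rewrite -in_nbhd.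
move: wNS; rewrite !inE negb_and negbK => /orP[/eqP wv|//].
by move: vw; rewrite wv in_nbhd adj_irrefl.
Qed.

Lemma local_dom_number_witness S :
  #|S| = l ->
  exists2 R, local_dominating l S R & #|R| <= local_dom_number G l.
Proof.
move=> cardS.
have : local_dom_number_at l S <= local_dom_number G l.
  by apply: (@leq_bigmax_cond _ _ (local_dom_number_at l)); apply/eqP.
(* If the bound is met only by the default [#|G|], any admissible set is small enough, and [~: S] is
   one. *)
case/bigminn_leP => [le_G|//]; exists (~: S); first exact: local_dominating_setC.
exact: leq_trans (max_card _) le_G.
Qed.

(** The threshold ranges over positive biases only. As [l > 0], some vertex of [S] has a neighbor;
    that neighbor is a target, and the empty set dominates nothing. *)
Lemma local_dom_number_gt0 : 0 < local_dom_number G l.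
Proof.
have [S [_ _ cardS]] : exists S, [/\ set0 \subset S, S \subset [set: G] & #|S| = l].
  have := @superset_card G set0 [set: G] l (sub0set _).
  rewrite cards0 cardsT => /(_ isT); rewrite (minn_idPl _) //.
  exact: leq_trans min_degree_card.
have [R /andP[_ /forall_inP domR]] := local_dom_number_witness cardS.
apply: leq_trans; rewrite card_gt0; apply/set0Pn.
have [v vS] : exists v, v \in S by apply/set0Pn; rewrite -card_gt0 cardS.
have [w] : exists w, w \in nbhd v.
  apply/set0Pn; rewrite -card_gt0; apply: leq_trans l_gt0 _.
  exact: leq_trans l_deg (min_degree_le v).
rewrite in_nbhd adj_sym => wv.
have /domR/orP[wR|/existsP[u /andP[uR _]]] : w \in local_targets l S.
- by apply/in_local_targets; left; exists v.
- by exists w.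
- by exists u.
Qed.

(** * Dominator's invariant at Staller's turns, [T] being the set she holds *)

Definition safe_position D T : Prop :=
  forall v, ~~ dominates D v ->
    (forall w, w \in T -> ~~ adj v w) /\ (v \in T -> degree v != l).

Lemma safe_position_degree D T v :
  safe_position D T -> ~~ dominates D v -> v \in T -> l < degree v.
Proof.
move=> safe /safe[_ dv] /dv.
by rewrite ltn_neqAle eq_sym => -> /=; apply: leq_trans l_deg (min_degree_le v).
Qed.

(** The bound [#|B| <= l] covers both a last move cut short and, with [B] empty, a board that is
    already full. *)
Lemma safe_position_dominating D T B :
  safe_position D T -> #|B| <= l -> unplayed D (T :|: B) = set0 ->
  dominating_set D.
Proof.
move=> safe leB full; apply/forallP => v; apply: contraT => vND.
have played u : (u \in D) || ((u \in T) || (u \in B)).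
  by have /setP/(_ u) := full; rewrite !inE => /negbFE.
have sub_NB : nbhd v \subset B.
  apply/subsetP => u; rewrite in_nbhd => vu.
  case/or3P: (played u) => // [uD|uT]; first by rewrite (dominates_adj uD vu) in vND.
  by have [/(_ u uT)] := safe v vND; rewrite vu.
have degB := subset_leq_card sub_NB.
case/or3P: (played v) => [vD|vT|vB]; first by rewrite /dominates vD in vND.
  have := safe_position_degree safe vND vT.
  by rewrite ltnNge (leq_trans degB leB).
(* For [v] in [B], the neighborhood also misses [v], so it has fewer than [l] vertices, against the
   minimum degree. *)
have /subset_leq_card : nbhd v \subset B :\ v.
  by rewrite subsetD1 sub_NB /= in_nbhd adj_irrefl.
move/(leq_trans (leq_trans l_deg (min_degree_le v))).
by rewrite leqNgt (leq_trans _ leB) // (cardsD1 v B) vB.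
Qed.

Lemma safe_position_reply D T B :
  safe_position D T -> #|B| = l ->
  exists A, [/\ A \subset unplayed D (T :|: B), #|A| <= local_dom_number G l
    & {in local_targets l B, forall v, dominates (D :|: A) v}].
Proof.
move=> safe cardB.
have [R /andP[/subsetP RB /forall_inP domR] cardR] := local_dom_number_witness cardB.
pose U := unplayed D (T :|: B).
(* Played vertices of [R] are traded for an unplayed neighbor. When there is none, the default [r]
   is outside [U] and the intersection with [U] drops it. *)
pose f r := if r \in U then r else odflt r [pick x in U | adj r x].
exists ([set f r | r in R] :&: U); split; first exact: subsetIr.
  apply: leq_trans cardR; apply: leq_trans (leq_imset_card f R).
  exact/subset_leq_card/subsetIl.
move=> v /domR domv; have [domD|vND] := boolP (dominates D v).
  exact: dominatesS (subsetUl _ _) domD.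
have [r rR vr] : exists2 r, r \in R & (v == r) || adj v r.
  by case/orP: domv => [vR|/existsP[r /andP[rR vr]]];
    [exists v; rewrite ?eqxx | exists r; rewrite ?vr ?orbT].
have frA : f r \in U -> f r \in D :|: [set f r | r in R] :&: U.
  by move=> frU; rewrite 2!inE frU imset_f ?orbT.
have [rU|rNU] := boolP (r \in U).
  have fr : f r = r by rewrite /f rU.
  rewrite fr in frA; case/orP: vr => [/eqP->|vr]; last exact: dominates_adj (frA rU) vr.
  by rewrite /dominates frA.
have rNB : r \notin B by have := RB r rR; rewrite inE.
have rNDT : (r \in D) || (r \in T).
  by move: rNU; rewrite !inE negbK (negPf rNB) orbF.
case/orP: rNDT => [rD|rT].
  case/orP: vr => [/eqP vr|vr]; last by rewrite (dominates_adj rD vr) in vND.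
  by rewrite vr /dominates rD in vND.
have [noT _] := safe v vND.
(* An undominated [v] has no neighbor in [T], so [r] is [v] itself. *)
case/orP: vr => [/eqP vr|vr]; last by have := noT r rT; rewrite vr.
rewrite vr in vND noT *.
have [x rx xNB] : exists2 x, x \in nbhd r & x \notin B.
  apply/subsetPn/negP => /subset_leq_card.
  by rewrite leqNgt cardB (safe_position_degree safe vND rT).
rewrite in_nbhd in rx.
have xU : x \in U.
  rewrite !inE (negPf xNB) orbF negb_or; apply/andP; split.
    by apply: contra vND => xD; apply: dominates_adj xD rx.
  by apply: contraL rx => /noT.
have [frU rfr] : f r \in U /\ adj r (f r).
  rewrite /f (negPf rNU); case: pickP => [y /andP[]//|/(_ x)].
  by rewrite xU rx.
exact: dominates_adj (frA frU) rfr.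
Qed.

Lemma safe_position_wins D T :
  safe_position D T -> dominator_wins (local_dom_number G l) l Staller D T.
Proof.
move: {2}#|_|.+1 (ltnSn #|unplayed D T|) => n.
elim: n => // n IHn in D T *; rewrite ltnS => leUn safe.
have [full|/eqP notfull] := eqVneq (unplayed D T) set0.
  apply: wins_end => //; apply: (safe_position_dominating (B := set0) safe).
    by rewrite cards0.
  by rewrite setU0.
apply: wins_staller_move => // B [sBU cardB].
have leB : #|B| <= l by rewrite cardB geq_minl.
have [full|/eqP notfullB] := eqVneq (unplayed D (T :|: B)) set0.
  by apply: wins_end => //; apply: safe_position_dominating safe leB full.
have unplayedD : unplayed D (T :|: B) = unplayed D T :\: B.
  by apply/setP => x; rewrite !inE !negb_or andbA andbC.
(* A move of fewer than [l] vertices would exhaust the board, contrary to [notfullB]. *)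
have cardBl : #|B| = l.
  apply/eqP; rewrite eqn_leq leB leqNgt; apply/negP => ltBl.
  apply: notfullB; apply/eqP; rewrite unplayedD -cards_eq0 cardsDS // subn_eq0.
  by move: ltBl; rewrite cardB gtn_min ltnn /= => /ltnW/minn_idPr->.
have [A0 [A0U cardA0 domA0]] := safe_position_reply safe cardBl.
(* The reply is padded to the size that the rules demand; extra vertices only help domination. *)
have [A [sA0A sAU cardA]] := superset_card A0U cardA0.
apply: (@wins_dominator_move _ _ _ _ _ A) => //.
apply: IHn => [|v vND].
  apply: leq_trans leUn; apply: proper_card; apply/properP; split.
    by rewrite setCS setUSS ?subsetUl.
  have [x xB] : exists x, x \in B by apply/set0Pn; rewrite -card_gt0 cardBl.
  by exists x; [exact: (subsetP sBU) | rewrite !inE xB !orbT].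
have [noT degT] : (forall w, w \in T -> ~~ adj v w) /\ (v \in T -> degree v != l).
  by apply: safe; apply: contra vND; apply: dominatesS; apply: subsetUl.
(* Not being a target of [B] is the invariant at [v] for the new vertices [B]; [T] is covered by the
   old invariant. *)
have vNtarget : v \notin local_targets l B.
  by apply: contra vND => /domA0; apply: dominatesS; apply: setUS.
split=> [w|]; rewrite inE => /orP[]; [exact: noT | move=> wB | exact: degT | move=> vB].
  by apply: contra vNtarget => vw; apply/in_local_targets; left; exists w.
by apply: contra vNtarget => /eqP dv; apply/in_local_targets; right.
Qed.

Lemma dominator_wins_Sgame_local_dom_number :
  dominator_wins_Sgame G (local_dom_number G l) l.
Proof. by apply: safe_position_wins => v _; split=> [w|]; rewrite inE. Qed.

End MinDegree.
End Domination.

Theorem theorem8 (l : nat) (hl : 0 < l) (G : sgraph) (hdeg : l <= min_degree G) :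
  leq_infty (Sgame_threshold G l) (Some (local_dom_number G l)).
Proof.
have good : (0 < local_dom_number G l) &&
    `[< dominator_wins_Sgame G (local_dom_number G l) l >].
  rewrite local_dom_number_gt0 //=; apply/asboolP.
  exact: dominator_wins_Sgame_local_dom_number.
rewrite /Sgame_threshold; case: pselect => [ex|[]]; last by eexists; exact: good.
by rewrite /=; case: ex_minnP => m _; apply.
Qed.
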